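(* Let $n\ge1$ be an integer, $s\in(0,1)$ and let $\Omega\subset\mathbb{R}^n$ be a bounded Lipschitz domain. There exists a constant $C=C(n,s,\Omega)>0$ such that for every $u\in\mathcal{H}^{s+\mathrm{Log}}_0(\Omega)$, $$[u]_{s+\mathrm{Log},+}^2\ \ge\ C\,\|u\|_{L^2(\Omega)}^2.$$
   Context: With $a_+:=\max\{0,a\}$, $c_{n,s}=2^{2s}\pi^{-n/2}s\frac{\Gamma((n+2s)/2)}{\Gamma(1-s)}$ and $\mathbf{k}_{s+\mathrm{Log},+}(z):=c_{n,s}|z|^{-n-2s}(-\ln|z|)_+$ for $z\ne0$, put $[u]_{s+\mathrm{Log},+}^2:=\iint_{\mathbb{R}^n\times\mathbb{R}^n}(u(x)-u(y))^2\,\mathbf{k}_{s+\mathrm{Log},+}(x-y)\,dx\,dy$ for real-valued $u\in L^2(\mathbb{R}^n)$, $\mathcal{H}^{s+\mathrm{Log}}(\mathbb{R}^n):=\{u\in L^2(\mathbb{R}^n):[u]_{s+\mathrm{Log},+}<\infty\}$, and $\mathcal{H}^{s+\mathrm{Log}}_0(\Omega):=\{u\in\mathcal{H}^{s+\mathrm{Log}}(\mathbb{R}^n):u=0\text{ a.e. in }\Omega^c\}$. *)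

(* Defs.v *)
From HB Require Import structures.
From mathcomp Require Import all_boot all_order all_algebra.
From mathcomp Require Import all_classical all_reals all_analysis.

Set Implicit Arguments.
Unset Strict Implicit.
Unset Printing Implicit Defensive.

Import Order.TTheory GRing.Theory Num.Def Num.Theory.
Import numFieldNormedType.Exports.

Local Open Scope classical_set_scope.
Local Open Scope ring_scope.

(* R^n is 'rV[R]_n.  It has a topology but no sigma-algebra yet: as for tuples,
   we take the one generated by the coordinates, i.e., the Borel sets. *)
Definition rV_display : measure_display -> measure_display.
Proof. exact. Qed.

Section measurable_rV.
Context {R : realType}.
Variable n : nat.

Definition rV_coord (i : 'I_n) (x : 'rV[R]_n) : measurableTypeR R := x 0 i.

Let rV_set0 : g_sigma_preimage rV_coord set0.
Proof. exact: sigma_algebra0. Qed.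

Let rV_setC A : g_sigma_preimage rV_coord A -> g_sigma_preimage rV_coord (~` A).
Proof. exact: sigma_algebraC. Qed.

Let rV_bigcup (F : _^nat) : (forall i, g_sigma_preimage rV_coord (F i)) ->
  g_sigma_preimage rV_coord (\bigcup_i (F i)).
Proof. exact: sigma_algebra_bigcup. Qed.

HB.instance Definition _ :=
  @isMeasurable.Build (rV_display R.-ocitv.-measurable.-sigma) 'rV[R]_n
    (g_sigma_preimage rV_coord) rV_set0 rV_setC rV_bigcup.

Lemma measurable_rV_coord (i : 'I_n) : measurable_fun setT (rV_coord i).
Proof.
move=> _ Y mY; rewrite setTI; apply: sub_sigma_algebra => /=.
rewrite -bigcup_seq/=; exists i => /=; first by rewrite mem_index_enum.
by exists Y => //; rewrite setTI.
Qed.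

Lemma measurable_fun_rV d (T : measurableType d) (f : T -> 'rV[R]_n) :
  (forall i, measurable_fun setT (rV_coord i \o f)) -> measurable_fun setT f.
Proof.
move=> mf; suff H : g_sigma_preimage (fun i => rV_coord i \o f) `<=` measurable.
  move: H; rewrite g_sigma_preimage_comp => H _ A mA.
  by apply: H; exists A.
apply: smallest_sub; first exact: sigma_algebra_measurable.
rewrite -bigcup_seq/=; apply: bigcup_sub => i _ A [B mB <-].
exact: mf.
Qed.

End measurable_rV.

(* Lebesgue measure on R^n is built by recursion on n as the image of the
   product measure under R * R^n -> R^n.+1. *)
Section lebesgue_step.
Context {R : realType} {n : nat}.

Definition rV_cons (p : measurableTypeR R * 'rV[R]_n) : 'rV[R]_n.+1 :=
  row_mx (const_mx p.1 : 'rV[R]_1) p.2.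

Definition rV_uncons (x : 'rV[R]_n.+1) : measurableTypeR R * 'rV[R]_n :=
  (x 0 0, rsubmx (x : 'rV[R]_(1 + n))).

Lemma rV_consK : cancel rV_cons rV_uncons.
Proof.
move=> [a x]; rewrite /rV_uncons /rV_cons /= row_mxKr; congr pair.
have -> : (0 : 'I_n.+1) = lshift n (0 : 'I_1) by exact/val_inj.
by rewrite (@row_mxEl _ 1 1 n) mxE.
Qed.

Lemma rV_cons0 p : rV_cons p 0 0 = p.1.
Proof. by rewrite -[p in RHS]rV_consK. Qed.

Lemma rV_consS p j : rV_cons p 0 (lift 0 j) = p.2 0 j.
Proof.
have -> : lift 0 j = rshift 1 j :> 'I_n.+1 by exact/val_inj.
by rewrite (@row_mxEr _ 1 1 n).
Qed.

Lemma measurable_rV_cons : measurable_fun setT rV_cons.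
Proof.
apply: measurable_fun_rV => i; have [j ->|->] := unliftP 0 i.
  rewrite [X in measurable_fun _ X](_ : _ = rV_coord j \o snd).
    by apply: measurableT_comp; [exact: measurable_rV_coord|].
  by apply/funext => p; rewrite /= /rV_coord rV_consS.
rewrite [X in measurable_fun _ X](_ : _ = fst)//.
by apply/funext => p; rewrite /= /rV_coord rV_cons0.
Qed.

Lemma measurable_rV_uncons : measurable_fun setT rV_uncons.
Proof.
apply/measurable_fun_pairP; split.
  exact: (@measurable_rV_coord R n.+1 0).
apply: measurable_fun_rV => j.
rewrite [X in measurable_fun _ X](_ : _ = rV_coord (rshift 1 j : 'I_n.+1)).
  exact: measurable_rV_coord.
by apply/funext => x; rewrite /= /rV_coord mxE.
Qed.

Variable mu : {sigma_finite_measure set 'rV[R]_n -> \bar R}.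

Definition lebesgue_step : set 'rV[R]_n.+1 -> \bar R :=
  pushforward (@lebesgue_measure R \x mu)%E rV_cons.

Let mrV_cons A : measurable A -> measurable (rV_cons @^-1` A).
Proof.
by move=> mA; rewrite -[X in measurable X]setTI; exact: measurable_rV_cons.
Qed.

Let lebesgue_step0 : lebesgue_step set0 = 0%E.
Proof. by rewrite /lebesgue_step /pushforward preimage_set0 measure0. Qed.

Let lebesgue_step_ge0 A : (0 <= lebesgue_step A)%E.
Proof. by rewrite /lebesgue_step /pushforward. Qed.

Let lebesgue_step_sigma_additive : semi_sigma_additive lebesgue_step.
Proof.
move=> F mF tF mUF; rewrite /lebesgue_step /pushforward preimage_bigcup.
apply: measure_semi_sigma_additive.
- by move=> k; apply: mrV_cons; exact: mF.
- by apply/trivIsetP => i j _ _ ij; rewrite -preimage_setI;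
    move/trivIsetP : tF => ->//; rewrite preimage_set0.
- by rewrite -preimage_bigcup; exact: mrV_cons.
Qed.

HB.instance Definition _ := isMeasure.Build _ _ _ lebesgue_step
  lebesgue_step0 lebesgue_step_ge0 lebesgue_step_sigma_additive.

Let lebesgue_step_sigma_finite : sigma_finite setT lebesgue_step.
Proof.
have /sigma_finiteP[F [TF ndF Foo]] := sigma_finiteT (@lebesgue_measure R).
have /sigma_finiteP[G [TG ndG Goo]] := sigma_finiteT mu.
exists (fun i => rV_uncons @^-1` (F i `*` G i)).
  apply/seteqP; split=> // x _.
  have [i _ Fi] : (\bigcup_i F i) (rV_uncons x).1 by rewrite -TF.
  have [j _ Gj] : (\bigcup_i G i) (rV_uncons x).2 by rewrite -TG.
  exists (maxn i j) => //; split.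
  - by move: Fi; exact/subsetPset/ndF/leq_maxl.
  - by move: Gj; exact/subsetPset/ndG/leq_maxr.
move=> i; have [mF Fi] := Foo i; have [mG Gi] := Goo i; split.
  rewrite -[X in measurable X]setTI.
  by apply: measurable_rV_uncons => //; exact: measurableX.
rewrite /lebesgue_step /pushforward -comp_preimage.
rewrite (_ : rV_uncons \o rV_cons = id) ?preimage_id.
  by rewrite product_measure1E// lte_mul_pinfty// ge0_fin_numE.
by apply/funext => p; exact: rV_consK.
Qed.

HB.instance Definition _ := Measure_isSigmaFinite.Build _ _ _ lebesgue_step
  lebesgue_step_sigma_finite.

End lebesgue_step.

Fixpoint lebesgue_rV (R : realType) (n : nat) :
    {sigma_finite_measure set 'rV[R]_n -> \bar R} :=
  match n with
  | 0 => \d_(0 : 'rV[R]_0)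
  | m.+1 => lebesgue_step (lebesgue_rV R m)
  end.

Lemma lebesgue_rV_box (R : realType) n (A : 'I_n -> set (measurableTypeR R)) :
  (forall i, measurable (A i)) ->
  lebesgue_rV R n [set x | forall i, A i (x 0 i)] =
  (\prod_(i < n) lebesgue_measure (A i))%E.
Proof.
elim: n A => [A _|n IH A mA].
  rewrite big_ord0 /= diracE mem_set//.
  by case.
have mB : measurable [set x : 'rV[R]_n | forall i, A (lift 0 i) (x 0 i)].
  rewrite [X in measurable X](_ : _ =
      \bigcap_(i in [set: 'I_n]) (rV_coord i @^-1` A (lift 0 i))).
    apply: fin_bigcap_measurable => // i _.
    by rewrite -[X in measurable X]setTI; exact: measurable_rV_coord.
  by apply/seteqP; split => x /= Ax i //=; exact: Ax.
rewrite big_ord_recl -IH// -product_measure1E//.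
rewrite /= /lebesgue_step /pushforward; congr product_measure1.
apply/seteqP; split => [p /= Ap|p /= [Ap0 ApS] i].
  by split=> [|j]; [have := Ap 0|have := Ap (lift 0 j)];
    rewrite ?rV_cons0 ?rV_consS.
by have [j ->|->] := unliftP 0 i; rewrite ?rV_cons0 ?rV_consS.
Qed.

(* The canonical norm `|x| on 'rV[R]_n is the sup norm. *)
Definition euclid_norm {R : realType} {n : nat} (x : 'rV[R]_n) : R :=
  Num.sqrt (\sum_(i < n) x 0 i ^+ 2).

Section lipschitz_domain.
Context {R : realType} {n : nat}.
Implicit Types (Omega : set 'rV[R]_n) (p x : 'rV[R]_n).

Definition boundary Omega : set 'rV[R]_n := closure Omega `\` Omega°.

(* In some orthonormal coordinates y = (x - p) Q centered at p, and in a ball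
   around p, Omega is the set of points above the graph y_n = phi(y') of a
   Lipschitz function, where y' is made of the first n - 1 coordinates of y. *)
Definition locally_lipschitz_epigraph Omega p : Prop :=
  exists (Q : 'M[R]_(n, n.-1 + 1)) (phi : 'rV[R]_n.-1 -> R) (k r : R),
    [/\ Q *m Q^T = 1%:M, Q^T *m Q = 1%:M, k.-lipschitz phi, 0 < r &
      forall x, euclid_norm (x - p) < r ->
        (Omega x <->
         phi (lsubmx ((x - p) *m Q)) < rsubmx ((x - p) *m Q) 0 0)].

Definition bounded_lipschitz_domain Omega : Prop :=
  [/\ Omega !=set0, open Omega, connected Omega, bounded_set Omega &
      forall p, boundary Omega p -> locally_lipschitz_epigraph Omega p].

End lipschitz_domain.

Definition Gamma {R : realType} (x : R) : R :=
  \int[lebesgue_measure]_(t in `]0, +oo[) (t `^ (x - 1) * expR (- t)).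

Definition pos_part {R : realType} (a : R) : R := maxr 0 a.

(* Elements of L^2 are Borel representatives of a.e. classes; nothing below
   depends on the representative. *)
Section sLog_space.
Context {R : realType} {n : nat}.
Variable s : R.
Implicit Types (u : 'rV[R]_n -> R) (Omega : set 'rV[R]_n) (z : 'rV[R]_n).

Definition c_ns : R :=
  2 `^ (2 * s) * pi `^ (- (n%:R / 2)) * s *
  (Gamma ((n%:R + 2 * s) / 2) / Gamma (1 - s)).

(* Only z <> 0 matters: {w | w.1 = w.2} is a null set on which, moreover, the
   integrand of sqseminorm_sLog vanishes. *)
Definition kernel_sLog z : R :=
  c_ns * euclid_norm z `^ (- n%:R - 2 * s) * pos_part (- ln (euclid_norm z)).

Definition sqseminorm_sLog u : \bar R :=
  (\int[lebesgue_rV R n \x lebesgue_rV R n]_w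
     ((u w.1 - u w.2) ^+ 2 * kernel_sLog (w.1 - w.2))%:E)%E.

Definition H_sLog : set ('rV[R]_n -> R) :=
  [set u | u \in Lfun (lebesgue_rV R n) 2%:E /\ (sqseminorm_sLog u < +oo)%E].

Definition H_sLog0 Omega : set ('rV[R]_n -> R) :=
  [set u | H_sLog u /\
           {ae lebesgue_rV R n, forall x, (~` Omega) x -> u x = 0}].

Definition normL2 Omega u : \bar R :=
  'N[lebesgue_rV R n]_2%:E[EFin \o (u \_ Omega)].

End sLog_space.

(* Main.v *)
Require Import Defs.
From HB Require Import structures.
From mathcomp Require Import all_boot all_order all_algebra.
From mathcomp Require Import all_classical all_reals all_analysis.
From mathcomp Require Import measurable_realfun ring lra.

(** Let I be the squared L^2 norm of u, and let D(z) be the integral over x of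
    (u(x + z) - u(x))^2.  In the coordinates (z, y) = (x - y, y), the seminorm is
    the integral over z of kernel(z) D(z).  Two facts bound it below.

    - The kernel is at least c_ns ln 2 when 0 < |z| <= 1/2
      ([kernel_sLog_ge]).  This is of use only if c_ns > 0, i.e., if the values
      of Gamma involved are finite and positive ([Gamma_gt0]).

    - D(N z) <= 4^N D(z) ([sq_increment_mulrn]): the increment of u along N z
      is a sum of N increments along translates of z, and Lebesgue measure is
      invariant under translations ([lebesgue_rV_shift]).  Since Omega is
      bounded, there is one N such that Omega and its translate by N z are
      disjoint for all z in the cube [a, b]^n, a > 0.  For such z, at a.e. x at
      least one of u(x) and u(x + N z) vanishes, so that D(N z) >= I, whence
      D(z) >= I / 4^N ([integral_sqr_le_sq_increment]).

    With b = 1/(2n), the cube lies in the region where the kernel is bounded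
    below, and integrating over it gives the inequality with
    C = c_ns ln 2 (b - a)^n / 4^N ([poincare_kernel]). *)

Set Implicit Arguments.
Unset Strict Implicit.
Unset Printing Implicit Defensive.

Import Order.TTheory GRing.Theory Num.Theory.
Import numFieldNormedType.Exports.

Local Open Scope classical_set_scope.
Local Open Scope ring_scope.

(** * Integrals of nonnegative functions *)

(** The integral of a nonnegative function is a supremum over the simple
    functions below it, hence monotone for arbitrary functions, such as the
    density of the seminorm and the restriction of a function to Omega. *)
Lemma ge0_le_integral_sup d (T : measurableType d) (R : realType)
    (mu : {measure set T -> \bar R}) (f g : T -> \bar R) :
  (forall x, 0 <= f x)%E -> (forall x, f x <= g x)%E ->
  (\int[mu]_x f x <= \int[mu]_x g x)%E.
Proof.
move=> f0 fg; have g0 x : (0 <= g x)%E by exact: le_trans (f0 x) (fg x).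
rewrite !ge0_integralTE//; apply: ereal_sup_le => _ [h /= hf <-].
by exists h => // x; exact: le_trans (hf x) (fg x).
Qed.

Lemma ge0_integral_preserving d (T : measurableType d) (R : realType)
    (mu : {measure set T -> \bar R}) (phi : T -> T) (f : T -> \bar R) :
  measurable_fun [set: T] phi ->
  (forall A, measurable A -> mu (phi @^-1` A) = mu A) ->
  measurable_fun [set: T] f -> (forall x, 0 <= f x)%E ->
  (\int[mu]_x f (phi x) = \int[mu]_x f x)%E.
Proof.
move=> mphi phimu mf f0.
have := ge0_integral_pushforward mphi mu measurableT mf (fun y _ => f0 y).
rewrite preimage_setT => <-.
by apply: eq_measure_integral => A mA _; exact: phimu.
Qed.

Section Lnorm2.
Context d (T : measurableType d) (R : realType) (mu : {measure set T -> \bar R}).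

Lemma Lnorm2_sqr (f : T -> R) :
  ('N[mu]_2%:E[EFin \o f] ^+ 2 = \int[mu]_x (f x ^+ 2)%:E)%E.
Proof.
have -> : ('N[mu]_2%:E[EFin \o f] ^+ 2 = 'N[mu]_2%:E[EFin \o f] `^ 2)%E.
  have := Lnorm_ge0 mu 2%:E (EFin \o f).
  case: ('N[mu]_2%:E[EFin \o f])%E => [r| |]//.
    by rewrite lee_fin => r0; rewrite poweR_EFin (powR_mulrn 2)// -EFin_expe.
  by rewrite poweRyr.
rewrite poweR_Lnorm//; apply: eq_integral => x _ /=.
by rewrite (powR_mulrn 2)// real_normK ?num_real.
Qed.
End Lnorm2.

(** * Translation invariance of Lebesgue measure on R^n *)

Lemma lebesgue_measure_shift (R : realType) (a : R)
    (A : set (measurableTypeR R)) :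
  measurable A ->
  lebesgue_measure ((fun x : measurableTypeR R => x + a) @^-1` A) =
  lebesgue_measure A.
Proof.
move=> mA.
have mphi : measurable_fun setT
    (fun x : measurableTypeR R => x + a : measurableTypeR R).
  exact: measurable_funD.
pose phi : {mfun measurableTypeR R >-> measurableTypeR R} :=
  HB.pack (fun x : measurableTypeR R => x + a : measurableTypeR R)
   (isMeasurableFun.Build _ _ _ _ _ mphi).
apply/esym.
apply: (@lebesgue_measure_unique _ (pushforward lebesgue_measure phi)) => //=.
move=> _ [[x y]] _ <-.
rewrite /pushforward.
have -> : phi @^-1` `]x, y] = `]x - a, y - a]%classic.
  by apply/seteqP; split => t; rewrite /= !in_itv/= ltrBlDr lerBrDr.
rewrite !lebesgue_measure_itv/= !lte_fin ltrD2r.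
by case: ifP => // _; congr (_%:E); ring.
Qed.

Section shift_rV.
Context {R : realType}.

Lemma measurable_rV_shift n (z : 'rV[R]_n) :
  measurable_fun [set: 'rV[R]_n] (fun x : 'rV[R]_n => x + z).
Proof.
apply: measurable_fun_rV => i.
rewrite (_ : _ \o _ = (fun x : 'rV[R]_n => rV_coord i x + z 0 i)).
  by apply: measurable_funD => //; exact: measurable_rV_coord.
by apply/funext => x; rewrite /rV_coord /= mxE.
Qed.

Lemma rV_consD n (p q : measurableTypeR R * 'rV[R]_n) :
  rV_cons p + rV_cons q = rV_cons ((p.1 + q.1 : measurableTypeR R), p.2 + q.2).
Proof.
apply/rowP => i; rewrite mxE.
by have [j ->|->] := unliftP 0 i; rewrite ?rV_cons0 ?rV_consS ?mxE.
Qed.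

Lemma rV_unconsK n : cancel (@rV_uncons R n) rV_cons.
Proof.
move=> x; apply/rowP => i.
have [j ->|->] := unliftP 0 i; rewrite ?rV_cons0 ?rV_consS ?mxE//=.
by congr (x _ _); apply/val_inj.
Qed.

(** By induction on the dimension: the section at x_0 of a translated set is a
    translate of the section at x_0 + z_0, so the measure of the translated set
    is the integral of a translate of the section measure, and the
    one-dimensional invariance applies. *)
Lemma lebesgue_rV_shift n (z : 'rV[R]_n) A : measurable A ->
  lebesgue_rV R n ((fun x : 'rV[R]_n => x + z) @^-1` A) = lebesgue_rV R n A.
Proof.
elim: n z A => [z A mA|n IH z A mA].
  by congr (_ _); apply/seteqP; split => x /=; rewrite !thinmx0.
rewrite /= /lebesgue_step /pushforward.
set B := rV_cons @^-1` A.
have mB : measurable B.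
  by rewrite -[X in measurable X]setTI; exact: measurable_rV_cons.
rewrite /product_measure1.
set w := rV_uncons z.
transitivity (\int[lebesgue_measure]_x
    (lebesgue_rV R n \o xsection B) (x + w.1 : measurableTypeR R)%R)%E.
  apply: eq_integral => x _ /=.
  rewrite -(IH w.2 (xsection B (x + w.1))); last exact: measurable_xsection.
  congr (_ _); apply/seteqP; split => y; rewrite /= /xsection/= !inE /B/=;
    by rewrite -[in rV_cons (x, y) + z](rV_unconsK z) rV_consD.
apply: (@ge0_integral_preserving _ (measurableTypeR R) R lebesgue_measure
  (fun x => x + w.1 : measurableTypeR R) (lebesgue_rV R n \o xsection B)).
- exact: measurable_funD.
- by move=> C mC; exact: lebesgue_measure_shift.
- exact: measurable_fun_xsection.
- by move=> x.
Qed.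
End shift_rV.

(** * Positivity of the Gamma function *)

Section Gamma_pos.
Context {R : realType}.
Local Notation mu := (@lebesgue_measure R).

Lemma integral_powR_itvcc (x a b : R) : 0 < x -> 0 < a < b ->
  (\int[mu]_(t in `[a, b]) (t `^ (x - 1))%:E = (x^-1 * (b `^ x - a `^ x))%:E)%E.
Proof.
move=> x0 /andP[a0 ab].
have pos t : t \in `[a, b] -> 0 < t.
  by rewrite in_itv/= => /andP[/(lt_le_trans a0)].
pose F t := x^-1 * t `^ x.
have dF (t : R) : 0 < t -> is_derive t 1 F (t `^ (x - 1)).
  move=> t0; have := @is_derive1_powR R x t t0.
  move=> /(is_deriveZ (f := @powR R ^~ x) x^-1).
  by rewrite /GRing.scale/= mulrA mulVf ?gt_eqF// mul1r.
have cF (t : R) : 0 < t -> {for t, continuous F}.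
  move=> t0; apply/differentiable_continuous/derivable1_diffP.
  by have [] := dF t t0.
rewrite (@continuous_FTC2 R _ F)//.
- by rewrite /F -EFinB mulrBr.
- apply: derivable_within_continuous => t /pos t0.
  by apply: derivable_powR; rewrite in_itv/= t0.
- split.
  + move=> t; rewrite in_itv/= => /andP[at_ _].
    by have [] := dF t (lt_trans a0 at_).
  + exact/cvg_at_right_filter/cF.
  + exact/cvg_at_left_filter/cF/(lt_trans a0).
- move=> t; rewrite in_itv/= => /andP[at_ _].
  by rewrite derive1E; have [_ ->] := dF t (lt_trans a0 at_).
Qed.

(** The primitive t^x / x is bounded by b^x / x uniformly as the lower bound of
    the interval tends to 0, because x > 0; monotone convergence along the
    intervals [1/(n+1), b] does the rest. *)
Lemma integral_powR_near0_lty (x b : R) : 0 < x -> 1 < b ->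
  (\int[mu]_(t in `]0%R, b]) (t `^ (x - 1))%:E < +oo)%E.
Proof.
move=> x0 b1; apply: (@le_lt_trans _ _ (x^-1 * b `^ x)%:E); last exact: ltry.
rewrite itv_open_bnd_bigcup.
pose F (n : nat) := [set` `[0 + n.+1%:R^-1, b]] : set (measurableTypeR R).
have cvgF : (\int[mu]_(t in F n) (t `^ (x - 1))%:E @[n --> \oo] -->
            \int[mu]_(t in \bigcup_n F n) (t `^ (x - 1))%:E)%E.
  apply: ge0_nondecreasing_set_cvg_integral.
  - move=> n m nm; rewrite subsetEset /F => t /=.
    rewrite !in_itv/= => /andP[nt ->]; rewrite andbT (le_trans _ nt)//.
    by rewrite !add0r lef_pV2 ?posrE ?ltr0n// ler_nat ltnS.
  - by move=> n; exact: measurable_itv.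
  - by move=> n; apply/measurable_EFinP/measurable_funTS; exact: measurable_powR.
  - by move=> n t _; rewrite lee_fin powR_ge0.
rewrite -(cvg_lim _ cvgF)//; apply: lime_le.
  by apply/cvg_ex; eexists; exact: cvgF.
apply: nearW => n; rewrite /F add0r integral_powR_itvcc//; last first.
  by rewrite invr_gt0 ltr0n/= (le_lt_trans _ b1)// invf_le1 ?ltr0n// ler1n.
rewrite lee_fin ler_wpM2l ?invr_ge0 ?(ltW x0)//.
by rewrite lerBlDr lerDl powR_ge0.
Qed.

(** From ln (e t) <= e t - 1, the logarithm is at most e t plus a constant for
    every slope e > 0; the slope below satisfies |a| e <= 1/2. *)
Lemma powR_le_expR (a : R) :
  exists2 K : R, 0 <= K & forall t, 1 <= t -> t `^ a <= K * expR (t / 2).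
Proof.
pose e := (2 * (`|a| + 1))^-1.
have a1 : 0 < `|a| + 1 by rewrite ltr_wpDl.
have e0 : 0 < e by rewrite invr_gt0 mulr_gt0.
exists (expR (- `|a| * (1 + ln e))); first exact: expR_ge0.
move=> t t1; have t0 : 0 < t by rewrite (lt_le_trans _ t1).
rewrite /powR gt_eqF// -expRD ler_expR.
have lnt : ln t <= e * t - 1 - ln e.
  have et0 := mulr_gt0 e0 t0.
  have : ln (1 + (e * t - 1)) <= e * t - 1 by apply: le_ln1Dx; lra.
  by rewrite (addrC 1) subrK lnM ?posrE//; lra.
have ea : `|a| * e <= 2^-1.
  by rewrite /e ler_pdivrMr ?mulr_gt0//; lra.
apply: (@le_trans _ _ (`|a| * ln t)).
  by rewrite ler_wpM2r ?ln_ge0// ler_norm.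
apply: (@le_trans _ _ (`|a| * (e * t - 1 - ln e))); first by rewrite ler_wpM2l.
have : `|a| * e * t <= 2^-1 * t by rewrite ler_wpM2r// ltW.
lra.
Qed.

Definition Gamma_integrand (x t : R) : R := t `^ (x - 1) * expR (- t).

Lemma measurable_Gamma_integrand x : measurable_fun setT (Gamma_integrand x).
Proof.
apply: measurable_funM; first exact: measurable_powR.
by apply: measurableT_comp => //.
Qed.

(** [Gamma] is the finite part of an extended integral, hence would be 0 if that
    integral diverged: finiteness is what makes [Gamma] positive.  The integrand
    is below t^(x - 1) on ]0, 2] and below a multiple of the density of an
    exponential law on ]2, +oo[. *)
Lemma Gamma_integral_lty (x : R) : 0 < x ->
  (\int[mu]_(t in `]0%R, +oo[) (Gamma_integrand x t)%:E < +oo)%E.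
Proof.
move=> x0.
have f0 t : (0 <= (Gamma_integrand x t)%:E)%E.
  by rewrite lee_fin mulr_ge0 ?powR_ge0 ?expR_ge0.
have mf D : measurable_fun D (fun t => (Gamma_integrand x t)%:E).
  apply/measurable_EFinP; apply: measurable_funTS.
  exact: measurable_Gamma_integrand.
have -> : `]0%R, +oo[%classic = `]0%R, 2] `|` `]2, +oo[ :> set R.
  by rewrite -itv_bndbnd_setU// bnd_simp.
rewrite ge0_integral_setU//; last first.
- apply/disj_setPS => t /=; rewrite !in_itv/= => -[/andP[_ t2]].
  by rewrite andbT ltNge t2.
- exact: mf.
apply: lte_add_pinfty.
  have lt12 : 1 < 2 :> R by rewrite ltr1n.
  apply: (@le_lt_trans _ _ _ _ _ _ (integral_powR_near0_lty x0 lt12)).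
  apply: ge0_le_integral => //=; first exact: mf.
    by apply/measurable_EFinP; apply: measurable_funTS; exact: measurable_powR.
  move=> t; rewrite in_itv/= => /andP[t0 _].
  by rewrite lee_fin ler_piMr ?powR_ge0// -expR0 ler_expR oppr_le0 ltW.
have [K K0 HK] := powR_le_expR (x - 1).
pose g t := (2 * K * exponential_pdf (2^-1) t)%:E.
have g0 t : (0 <= g t)%E.
  by rewrite lee_fin !mulr_ge0// exponential_pdf_ge0.
have mg : measurable_fun setT g.
  apply/measurable_EFinP/measurable_funM => //; exact: measurable_exponential_pdf.
apply: (@le_lt_trans _ _ (\int[mu]_t g t)%E).
  apply: (@le_trans _ _ (\int[mu]_(t in `]2%R, +oo[) g t)%E).
    apply: ge0_le_integral => //; [exact: mf|exact: measurable_funTS|].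
    move=> t /=; rewrite in_itv/= andbT => t2.
    rewrite lee_fin exponential_pdfE; last by lra.
    rewrite (_ : 2 * K * _ = (K * expR (t / 2)) * expR (- t)).
      by rewrite ler_wpM2r ?expR_ge0// HK//; lra.
    rewrite -[RHS]mulrA -expRD (_ : t / 2 - t = - 2^-1 * t); first by field.
    lra.
  by apply: ge0_subset_integral.
rewrite /g; under eq_integral do rewrite EFinM.
rewrite ge0_integralZl//.
- by rewrite integral_exponential_pdf ?invr_gt0// mule1 ltry.
- apply/measurable_EFinP; exact: measurable_exponential_pdf.
- by move=> t _; rewrite lee_fin exponential_pdf_ge0.
- by rewrite lee_fin mulr_ge0.
Qed.

Lemma Gamma_gt0 (x : R) : 0 < x -> 0 < Gamma x.
Proof.
move=> x0; rewrite /Gamma /Rintegral fine_gt0// Gamma_integral_lty// andbT.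
have f0 t : 0 < t -> (0 < (Gamma_integrand x t)%:E)%E.
  by move=> t0; rewrite lte_fin mulr_gt0 ?powR_gt0 ?expR_gt0.
have mf D : measurable_fun D (fun t => (Gamma_integrand x t)%:E).
  apply/measurable_EFinP; apply: measurable_funTS.
  exact: measurable_Gamma_integrand.
rewrite lt0e integral_ge0 ?andbT; last first.
  by move=> t /=; rewrite in_itv/= andbT => /f0/ltW.
apply/eqP => int0.
have : (\int[mu]_(t in `]0%R, +oo[) `|(Gamma_integrand x t)%:E| = 0)%E.
  rewrite -[RHS]int0; apply: eq_integral => t.
  rewrite inE/= in_itv/= andbT => /f0/ltW.
  exact: gee0_abs.
(* The integrand would vanish a.e., hence ]0, 1] would be a null set. *)
move/ae_eq_integral_abs => /(_ (measurable_itv _) (mf _)) [N [mN N0]] sN.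
have : (mu `]0%R, 1%R]%classic <= mu N)%E.
  apply: le_measure; rewrite ?inE//=.
  move=> t /=; rewrite in_itv/= => /andP[t0 _]; apply: sN => /=.
  rewrite in_itv/= andbT => /(_ t0) E.
  by have := f0 _ t0; rewrite E ltxx.
by rewrite N0 lebesgue_measure_itv/= lte_fin ltr01 oppr0 adde0 lee_fin ler10.
Qed.
End Gamma_pos.

(** * Lower bound on the kernel *)

Section kernel.
Context {R : realType} {n : nat}.
Implicit Types (s : R) (z : 'rV[R]_n).

Lemma c_ns_gt0 s : 0 < s < 1 -> 0 < @c_ns R n s.
Proof.
move=> /andP[s0 s1]; rewrite /c_ns.
have n0 : 0 <= n%:R :> R by rewrite ler0n.
by rewrite !mulr_gt0 ?invr_gt0 ?powR_gt0 ?pi_gt0 ?Gamma_gt0//; lra.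
Qed.

Lemma euclid_norm_gt0 z i : z 0 i != 0 -> 0 < euclid_norm z.
Proof.
move=> zi; rewrite sqrtr_gt0 (bigD1 i)//= ltr_wpDr ?exprn_even_gt0//.
by apply: sumr_ge0 => j _; exact: sqr_ge0.
Qed.

Lemma euclid_norm_le z (b : R) : 0 <= b -> (forall i, `|z 0 i| <= b) ->
  euclid_norm z <= n%:R * b.
Proof.
move=> b0 zb; rewrite -[leRHS]ger0_norm ?mulr_ge0// -sqrtr_sqr ler_wsqrtr//.
have : \sum_(i < n) z 0 i ^+ 2 <= \sum_(i < n) b ^+ 2.
  by apply: ler_sum => i _; rewrite -real_normK ?num_real// lerXn2r ?nnegrE// zb.
rewrite sumr_const card_ord => /le_trans; apply.
rewrite -(mulr_natl (b ^+ 2)) exprMn ler_wpM2r ?sqr_ge0// -natrX ler_nat.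
by case: (n) => // m; rewrite expnS leq_pmulr// expn_gt0.
Qed.

(** With r = |z| <= 1/2, the power r^(-n-2s) is at least 1 and -ln r is at least
    ln 2. *)
Lemma kernel_sLog_ge s z : 0 < s < 1 -> 0 < euclid_norm z <= 2^-1 ->
  @c_ns R n s * ln 2 <= kernel_sLog s z.
Proof.
move=> s01 /andP[r0 r2]; have c0 := c_ns_gt0 s01; case/andP: s01 => s0 s1.
rewrite /kernel_sLog -mulrA ler_wpM2l ?(ltW c0)//.
have ln2 : 0 <= ln 2 :> R by rewrite ln_ge0// ler1n.
rewrite -[leLHS]mul1r ler_pM//.
  rewrite -[leLHS](powRr0 (euclid_norm z)); apply: ger_powR.
    by rewrite r0/=; lra.
  by have := ler0n R n; lra.
rewrite /pos_part le_max; apply/orP; right.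
rewrite lerNr -lnV ?posrE// ler_ln ?posrE// invr_gt0//.
Qed.

Lemma kernel_sLog_ge0 s z : 0 < s < 1 -> 0 <= kernel_sLog s z.
Proof.
move=> /c_ns_gt0 c0; rewrite /kernel_sLog /pos_part.
by rewrite mulr_ge0 ?le_max ?lexx// mulr_ge0 ?powR_ge0// ltW.
Qed.
End kernel.

(** * Increments of a function under iterated translations *)

Section shift_increments.
Context {R : realType} {n : nat}.
Local Notation mu := (lebesgue_rV R n).
Implicit Types (u : 'rV[R]_n -> R) (z : 'rV[R]_n).

Lemma ge0_integral_rV_shift (f : 'rV[R]_n -> \bar R) z :
  measurable_fun [set: 'rV[R]_n] f -> (forall x, 0 <= f x)%E ->
  (\int[mu]_x f (x + z)%R = \int[mu]_x f x)%E.
Proof.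
apply: (@ge0_integral_preserving _ _ _ mu (fun x => x + z)).
- exact: measurable_rV_shift.
- by move=> A; exact: lebesgue_rV_shift.
Qed.

Definition sq_increment u z : \bar R :=
  (\int[mu]_x ((u (x + z)%R - u x) ^+ 2)%:E)%E.

Lemma measurable_sq_increment u z : measurable_fun [set: 'rV[R]_n] u ->
  measurable_fun [set: 'rV[R]_n]
    (fun x : 'rV[R]_n => ((u (x + z)%R - u x) ^+ 2)%:E).
Proof.
move=> meas_u; apply/measurable_EFinP/measurable_funX/measurable_funB => //.
by apply: (measurableT_comp meas_u); exact: measurable_rV_shift.
Qed.

(** Split u(x + w + z) - u(x) at u(x + w); translation invariance turns the
    first part into the increment along z. *)
Lemma sq_incrementD u z w : measurable_fun [set: 'rV[R]_n] u ->
  (sq_increment u (z + w)%R <=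
   2%:E * sq_increment u z + 2%:E * sq_increment u w)%E.
Proof.
move=> meas_u.
have m1 := measurable_sq_increment z meas_u.
have m2 := measurable_sq_increment w meas_u.
have m1w : measurable_fun [set: 'rV[R]_n]
    (fun x : 'rV[R]_n => ((u (x + w + z)%R - u (x + w)) ^+ 2)%:E).
  by apply: (measurableT_comp m1); exact: measurable_rV_shift.
have -> : sq_increment u z =
    (\int[mu]_x ((u (x + w + z)%R - u (x + w)%R) ^+ 2)%:E)%E.
  by rewrite -[LHS](ge0_integral_rV_shift w m1)// => x; rewrite lee_fin sqr_ge0.
rewrite /sq_increment.
rewrite -!ge0_integralZl//=; try by move=> x _; rewrite lee_fin sqr_ge0.
rewrite -ge0_integralD//=;
  try by move=> x _; rewrite -EFinM lee_fin mulr_ge0 ?sqr_ge0.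
- apply: ge0_le_integral_sup => x; first by rewrite lee_fin sqr_ge0.
  rewrite -!EFinM -EFinD lee_fin addrA (addrAC x).
  set a := u (x + w + z); set b := u (x + w); set c := u x.
  by have := sqr_ge0 (a - b - (b - c)); nra.
- exact: measurable_funeM.
- exact: measurable_funeM.
Qed.

(** The triangle inequality in L^2 would give N^2 in place of 4^N; the cruder
    constant follows from [sq_incrementD] alone, since 2 4^N + 2 <= 4^(N+1). *)
Lemma sq_increment_mulrn u z N : measurable_fun [set: 'rV[R]_n] u ->
  (sq_increment u (z *+ N)%R <= (4 ^+ N)%:E * sq_increment u z)%E.
Proof.
move=> meas_u; have i0 w : (0 <= sq_increment u w)%E.
  by apply: integral_ge0 => x _; rewrite lee_fin sqr_ge0.
elim: N => [|N IH].
  rewrite /sq_increment mulr0n; under eq_integral do rewrite addr0 subrr expr0n.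
  by rewrite integral0 mule_ge0//; exact: i0.
rewrite mulrSr (le_trans (sq_incrementD _ _ meas_u))//.
apply: (@le_trans _ _ (2%:E * ((4 ^+ N)%:E * sq_increment u z) +
                       2%:E * sq_increment u z)%E).
  by rewrite leeD2r// lee_wpmul2l.
rewrite muleA -EFinM -ge0_muleDl ?lee_fin ?mulr_ge0 ?exprn_ge0//.
rewrite -EFinD lee_wpmul2r// lee_fin exprS.
have : 1 <= 4 ^+ N :> R by rewrite exprn_ege1// ler1n.
lra.
Qed.

Lemma ae_rV_shift (P : 'rV[R]_n -> Prop) z :
  {ae mu, forall x, P x} -> {ae mu, forall x : 'rV[R]_n, P (x + z)}.
Proof.
move=> [N [mN N0 PN]]; exists ((fun x : 'rV[R]_n => x + z) @^-1` N); split.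
- by rewrite -[X in measurable X]setTI; exact: measurable_rV_shift.
- by rewrite lebesgue_rV_shift.
- by move=> x nP; apply: PN.
Qed.

(** When u and its translate by N z have a.e. disjoint supports, the increment
    of u along N z dominates |u| almost everywhere. *)
Lemma integral_sqr_le_sq_increment u z N : measurable_fun [set: 'rV[R]_n] u ->
  {ae mu, forall x, u x = 0 \/ u (x + z *+ N) = 0} ->
  (\int[mu]_x (u x ^+ 2)%:E <= (4 ^+ N)%:E * sq_increment u z)%E.
Proof.
move=> meas_u u0; apply: (le_trans _ (sq_increment_mulrn _ _ meas_u)).
apply: ae_ge0_le_integral => //.
- by move=> x _; rewrite lee_fin sqr_ge0.
- exact/measurable_EFinP/measurable_funX.
- by move=> x _; rewrite lee_fin sqr_ge0.
- exact: measurable_sq_increment.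
apply: filterS u0 => x [->|->] _; rewrite lee_fin.
  by rewrite expr0n/= sqr_ge0.
by rewrite sub0r sqrrN.
Qed.
End shift_increments.

(** * A Poincare inequality for nonlocal energies *)

Section poincare.
Context {R : realType} {n : nat}.
Local Notation mu := (lebesgue_rV R n).

(** Tonelli in the coordinates (x - y, y), which preserve the product measure. *)
Lemma integral_difference_coordinates (G : 'rV[R]_n * 'rV[R]_n -> \bar R) :
  measurable_fun [set: 'rV[R]_n * 'rV[R]_n] G -> (forall w, 0 <= G w)%E ->
  (\int[mu]_z \int[mu]_y G ((z + y)%R, y) = \int[mu \x mu]_w G w)%E.
Proof.
move=> mG G0.
pose phi (w : 'rV[R]_n * 'rV[R]_n) := (w.1 + w.2, w.2).
have mphi : measurable_fun [set: 'rV[R]_n * 'rV[R]_n] phi.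
  apply: measurable_fun_pair => //; apply: measurable_fun_rV => i.
  rewrite (_ : _ \o _ = (fun w : 'rV[R]_n * 'rV[R]_n =>
      rV_coord i w.1 + rV_coord i w.2)).
    by apply: measurable_funD;
      apply: (measurableT_comp (measurable_rV_coord i)).
  by apply/funext => w; rewrite /rV_coord /= mxE.
have mg : measurable_fun [set: 'rV[R]_n * 'rV[R]_n] (G \o phi).
  exact: measurableT_comp mphi.
transitivity (\int[mu]_y \int[mu]_z (G \o phi) (z, y))%E.
  by apply: (fubini_tonelli (G \o phi)) => // w; exact: G0.
rewrite fubini_tonelli2//.
apply: eq_integral => y _; rewrite /fubini_G.
apply: (@ge0_integral_rV_shift _ _ (fun x => G (x, y)) y) => //.
by apply: (measurableT_comp mG); exact: measurable_fun_pair.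
Qed.

(** A kernel bounded below by k0 on B pays, for each displacement z in B, at
    least k0 times the squared increment of u along z, and each such increment
    controls the L^2 norm of u as soon as N steps of size z leave the support.
    Integrating over B gives a bound proportional to the measure of B. *)
Lemma poincare_kernel (K : 'rV[R]_n -> R) (B : set 'rV[R]_n) (k0 : R) (N : nat)
    (u : 'rV[R]_n -> R) :
  (forall z, 0 <= K z) -> measurable B -> 0 <= k0 ->
  (forall z, B z -> k0 <= K z) ->
  measurable_fun [set: 'rV[R]_n] u ->
  (forall z, B z -> {ae mu, forall x, u x = 0 \/ u (x + z *+ N) = 0}) ->
  ((k0 / 4 ^+ N)%:E * (\int[mu]_x (u x ^+ 2)%:E) * mu B <=
   \int[mu \x mu]_w ((u w.1 - u w.2) ^+ 2 * K (w.1 - w.2))%:E)%E.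
Proof.
move=> K0 mB k00 kK meas_u u0.
set I := (\int[mu]_x _)%E.
have I0 : (0 <= I)%E by apply: integral_ge0 => x _; rewrite lee_fin sqr_ge0.
have N4 : 0 < 4 ^+ N :> R by rewrite exprn_gt0.
(* Replacing K, an arbitrary function, by k0 on B and by 0 elsewhere makes the
   energy density measurable, so that Tonelli's theorem applies to it. *)
pose G (w : 'rV[R]_n * 'rV[R]_n) :=
  ((u w.1 - u w.2) ^+ 2 * (k0 * \1_B (w.1 - w.2)))%:E.
have G0 w : (0 <= G w)%E.
  by rewrite lee_fin mulr_ge0 ?sqr_ge0// mulr_ge0.
have mG : measurable_fun [set: 'rV[R]_n * 'rV[R]_n] G.
  apply/measurable_EFinP; apply: measurable_funM.
    apply: measurable_funX; apply: measurable_funB.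
      exact: (measurableT_comp meas_u).
    exact: (measurableT_comp meas_u).
  apply: measurable_funM => //.
  apply: (measurableT_comp (measurable_indic mB)).
  apply: measurable_fun_rV => i.
  rewrite (_ : _ \o _ = (fun w : 'rV[R]_n * 'rV[R]_n =>
      rV_coord i w.1 - rV_coord i w.2)).
    by apply: measurable_funB;
      apply: (measurableT_comp (measurable_rV_coord i)).
  by apply/funext => w; rewrite /rV_coord /= !mxE.
apply: (@le_trans _ _ (\int[mu \x mu]_w G w)%E); last first.
  apply: ge0_le_integral_sup => // w.
  rewrite lee_fin ler_wpM2l ?sqr_ge0//; rewrite indicE.
  by case: (boolP (_ \in B)) => [/set_mem/kK|_]; rewrite ?mulr1 ?mulr0.
rewrite -integral_difference_coordinates//.
rewrite -(integral_cst mu mB) integral_mkcond.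
apply: ge0_le_integral_sup => z; rewrite patchE.
  by case: ifPn => // _; rewrite mule_ge0// lee_fin divr_ge0// ltW.
case: ifPn => [zB|_]; last by apply: integral_ge0.
have Bz := set_mem zB.
apply: (@le_trans _ _ (k0%:E * sq_increment u z)%E).
  have -> : k0%:E = ((k0 / 4 ^+ N)%:E * (4 ^+ N)%:E)%E.
    by rewrite -EFinM divfK ?gt_eqF.
  rewrite -muleA; apply: lee_wpmul2l; first by rewrite lee_fin divr_ge0// ltW.
  exact: integral_sqr_le_sq_increment meas_u (u0 z Bz).
rewrite -ge0_integralZl//=.
- apply: ge0_le_integral_sup => x.
    by rewrite -EFinM lee_fin mulr_ge0 ?sqr_ge0.
  by rewrite /G/= addrK indicE zB mulr1 -EFinM lee_fin mulrC (addrC x).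
- exact: measurable_sq_increment.
- by move=> x _; rewrite lee_fin sqr_ge0.
Qed.
End poincare.

(** * Cubes and bounded sets *)

Definition cube {R : realType} (n : nat) (a b : R) : set 'rV[R]_n :=
  [set z | forall i, `[a, b]%classic (z 0 i)].
Arguments cube {R} n a b.

Section cube.
Context {R : realType}.
Implicit Types a b : R.

Lemma measurable_cube n a b : measurable (cube n a b).
Proof.
rewrite (_ : cube n a b =
    \bigcap_(i in [set: 'I_n]) (rV_coord i @^-1` `[a, b]%classic)).
  apply: fin_bigcap_measurable => // i _.
  by rewrite -[X in measurable X]setTI; exact: measurable_rV_coord.
by apply/seteqP; split => [z Az i _|z Az i]; [exact: Az|exact: (Az i I)].
Qed.

Lemma lebesgue_rV_cube n a b : a < b ->
  lebesgue_rV R n (cube n a b) = ((b - a) ^+ n)%:E.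
Proof.
move=> ab; rewrite (@lebesgue_rV_box R n (fun=> `[a, b]%classic))//.
under eq_bigr do rewrite lebesgue_measure_itv/= lte_fin ab -EFinD.
by rewrite prodEFin prodr_const card_ord.
Qed.

Lemma bounded_coord n (A : set 'rV[R]_n) : bounded_set A ->
  exists M : R, forall x, A x -> forall i, `|x 0 i| <= M.
Proof.
move=> [M [_ bM]]; exists (`|M| + 1) => x Ax i.
have /(bM _) /(_ _ Ax) : M < `|M| + 1 by rewrite ltr_pwDr// ler_norm.
apply: le_trans; rewrite [leRHS]mx_normrE.
exact: (le_bigmax _ (fun ij : 'I_1 * 'I_n => `|x ij.1 ij.2|) (0, i)).
Qed.

End cube.

(** * The fractional-logarithmic Poincare inequality *)

Theorem proposition1p4 (R : realType) (n : nat) (n_ge1 : (1 <= n)%N)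
    (s : R) (s_gt0 : 0 < s) (s_lt1 : s < 1)
    (Omega : set 'rV[R]_n) (Omega_dom : bounded_lipschitz_domain Omega) :
  exists C : R, 0 < C /\
    forall u : 'rV[R]_n -> R, H_sLog0 s Omega u ->
      (C%:E * normL2 Omega u ^+ 2 <= sqseminorm_sLog s u)%E.
Proof.
have s01 : 0 < s < 1 by rewrite s_gt0.
have [_ _ _ /bounded_coord[M OmegaM] _] := Omega_dom.
pose i0 : 'I_n := Ordinal n_ge1.
have n0 : 0 < n%:R :> R by rewrite ltr0n.
(* Displacements in the cube [a, b]^n have Euclidean norm at most n b = 1/2,
   where the kernel is bounded below, and advance by at least a > 0 along the
   first axis. *)
pose b : R := (2 * n%:R)^-1; pose a : R := b / 2.
have b0 : 0 < b by rewrite invr_gt0 mulr_gt0.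
have ab : 0 < a < b by rewrite /a; lra.
case/andP: ab => a0 ab.
(* Omega has width at most 2 M along the first axis, so N steps leave it. *)
pose N := (Num.truncn (2 * M / a)).+1.
have NM : 2 * M < a * N%:R by rewrite (mulrC a) -ltr_pdivrMr// truncnS_gt.
pose B := cube n a b.
have BK z : B z -> @c_ns R n s * ln 2 <= kernel_sLog s z.
  move=> Bz; have zi i : a <= z 0 i <= b by have := Bz i; rewrite /= in_itv.
  apply: kernel_sLog_ge => //; rewrite (@euclid_norm_gt0 _ _ _ i0)/=; last first.
    by rewrite gt_eqF//; have /andP[+ _] := zi i0; exact: lt_le_trans.
  apply: le_trans (@euclid_norm_le _ _ _ b (ltW b0) _) _.
    by move=> i; have /andP[ai ib] := zi i; rewrite ger0_norm// (le_trans (ltW a0)).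
  by rewrite /b invfM mulrCA divff ?gt_eqF// mulr1.
have k00 : 0 < @c_ns R n s * ln 2.
  by rewrite mulr_gt0 ?c_ns_gt0// ln_gt0// ltr1n.
exists (@c_ns R n s * ln 2 / 4 ^+ N * (b - a) ^+ n); split.
  by rewrite mulr_gt0 ?divr_gt0 ?exprn_gt0// subr_gt0.
move=> u [[uL2 _] u0].
have meas_u : measurable_fun [set: 'rV[R]_n] u.
  by move/sub_Lfun_mfun : uL2; rewrite inE.
have vanish z : B z ->
    {ae lebesgue_rV R n, forall x, u x = 0 \/ u (x + z *+ N) = 0}.
  move=> Bz; have := ae_rV_shift (z *+ N) u0; apply: filterS2 u0 => x ux uxz.
  have [Ox|/ux ->] := pselect (Omega x); last by left.
  right; apply: uxz => /OmegaM/(_ i0); apply/negP; rewrite -ltNge.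
  have xM := OmegaM _ Ox i0; rewrite mxE mulmxnE.
  have az : a * N%:R <= z 0 i0 *+ N.
    rewrite -(mulr_natr (z 0 i0)) ler_wpM2r//.
    by have := Bz i0; rewrite /= in_itv => /andP[].
  move: xM; rewrite ler_norml => /andP[xM _].
  by apply: lt_le_trans (ler_norm _); lra.
have := poincare_kernel (fun z => kernel_sLog_ge0 z s01) (measurable_cube a b)
  (ltW k00) BK meas_u vanish.
rewrite (lebesgue_rV_cube _ ab) => /(le_trans _); apply.
rewrite muleAC -EFinM lee_wpmul2l//.
  rewrite lee_fin mulr_ge0 ?exprn_ge0 ?subr_ge0 ?(ltW ab)//.
  by rewrite divr_ge0 ?exprn_ge0// ltW.
rewrite Lnorm2_sqr; apply: ge0_le_integral_sup => x; rewrite lee_fin ?sqr_ge0//.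
by rewrite patchE; case: ifPn => // _; rewrite expr0n sqr_ge0.
Qed.
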